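(* There is a positive constant $\varepsilon$ such that any graph $G$ on vertex set $[n]$ with less than $\varepsilon \frac{n^2}{k^2 \log k}$ edges contains a $k$-term independent arithmetic progression.
   Context: Here $[n] = \{1, \ldots, n\}$. A $k$-term arithmetic progression is a set of the form $\{a, a+d, \ldots, a+(k-1)d\}$ with $d \geq 1$ an integer. Given a graph with vertex set $[n]$, a $k$-term arithmetic progression (of elements of $[n]$) is said to be independent if it is an independent set in the graph, i.e., no two of its elements are joined by an edge. All logarithms are to base $e$.
   Formalization: The formal statement assumes 2 ≤ k ≤ n: for k = 1 the bound divides by log 1 = 0, and for 1 ≤ n < k the edgeless graph meets the edge bound although [n] contains no k-term arithmetic progression. *)

(* Defs.v *)
From mathcomp Require Import all_boot all_order all_algebra.
From mathcomp Require Import reals exp.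

Set Implicit Arguments.
Unset Strict Implicit.
Unset Printing Implicit Defensive.

Record sgraph (V : finType) := SGraph {
  adj : rel V;
  adj_sym : symmetric adj;
  adj_irr : irreflexive adj
}.

(* Edges are unordered pairs, so each edge is counted once. *)
Definition edges (V : finType) (G : sgraph V) : {set {set V}} :=
  [set e : {set V} | [exists x, exists y, adj G x y && (e == [set x; y])]].

Definition independent (V : finType) (G : sgraph V) (S : {set V}) : Prop :=
  forall x y : V, x \in S -> y \in S -> ~~ adj G x y.

(* The vertex set [n] = {1, ..., n} is encoded by 'I_n, the ordinal i
   (0 <= i < n) standing for the integer i + 1. *)
Definition label (n : nat) (v : 'I_n) : nat := v.+1.

(* The labels of S are exactly a, a + d, ..., a + (k - 1) d. Taking a in nat
   loses nothing for k > 0, as a is itself a label. *)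
Definition is_ap (n k : nat) (S : {set 'I_n}) : Prop :=
  exists a d : nat,
    (0 < d)%N /\ [seq label v | v in S] =i [seq (a + i * d)%N | i <- iota 0 k].

(* Main.v *)
Require Import Defs.
From mathcomp Require Import all_boot all_order all_algebra.
From mathcomp Require Import reals exp.
From mathcomp Require Import zify ring lra.

Import Order.TTheory GRing.Theory Num.Theory.
Local Open Scope ring_scope.

(* Put T = n / (2k) and count, with weights w on the differences d <= T, the
   progressions a, a + d, ..., a + (k - 1) d spoiled by some edge. An edge whose
   endpoints differ by D spoils at most k starting points a for each d such
   that d | D and D / d < k, so it suffices to find w of total mass of order
   T / ln k (up to a common scaling) for which every D carries bounded mass.
   - If T >= k^24, let w be the indicator of the d all of whose prime factors
     are >= k. Since D / d < k has only prime factors < k, d is determined by D.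
     The number of such d <= T is of order at least T / ln k: by Chebyshev's
     bound, ln T times this number dominates T times the sum of 1/m over such
     m <= T / k^12, and that sum times the sum of 1/s over s with all prime
     factors < k, itself O(ln k), dominates the harmonic sum.
   - If T < k^24, let w be the von Mangoldt function: D carries mass at most
     ln D <= ln n = O(ln k), and the total mass is of order T by Chebyshev. *)

(** * Prime powers and the von Mangoldt function *)

Section PrimePowerSums.
Context {R : realType}.
Implicit Types N d j m : nat.

(** A pair (p, a) stands for the prime power p^a; keeping the base at hand makes [ln u.1] the von
    Mangoldt function at [pw u]. *)
Definition primepows N : {set 'I_N.+1 * 'I_N.+1} :=
  [set u : 'I_N.+1 * 'I_N.+1 | [&& prime u.1, (0 < u.2)%N & (u.1 ^ u.2 <= N)%N]].

Definition pw {N} (u : 'I_N.+1 * 'I_N.+1) : nat := (u.1 ^ u.2)%N.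

Lemma primepowsP N (u : 'I_N.+1 * 'I_N.+1) : u \in primepows N ->
  [/\ prime u.1, (0 < u.2)%N, (0 < pw u)%N & (pw u <= N)%N].
Proof.
by rewrite inE => /and3P[p a le]; split=> //; rewrite expn_gt0 prime_gt0.
Qed.

Lemma ln_nat_ge0 (n : nat) : 0 <= ln n%:R :> R.
Proof.
by case: n => [|n]; [rewrite ln0 | apply: ln_ge0; rewrite ler1n].
Qed.

Lemma ln_nat_le (m n : nat) : (0 < m)%N -> (m <= n)%N -> ln m%:R <= ln n%:R :> R.
Proof.
by move=> m0 mn; rewrite ler_ln ?posrE ?ltr0n ?ler_nat ?(leq_trans m0 mn).
Qed.

Lemma ln_natM (m n : nat) : (0 < m)%N -> (0 < n)%N ->
  ln (m * n)%:R = ln m%:R + ln n%:R :> R.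
Proof. by move=> m0 n0; rewrite natrM lnM ?posrE ?ltr0n. Qed.

Lemma ln_natX (m a : nat) : (0 < m)%N -> ln (m ^ a)%:R = ln m%:R *+ a :> R.
Proof. by move=> m0; rewrite natrX lnXn ?ltr0n. Qed.

Lemma ln_sum_primes d N : (0 < d)%N -> (d <= N)%N ->
  ln d%:R = \sum_(p < N.+1 | prime p) ln p%:R *+ logn p d :> R.
Proof.
move=> d0 dN; rewrite -{1}(partnT d0) (widen_partn _ dN) big_mkord.
transitivity (\sum_(p < N.+1) ln (p%:R ^+ logn p d) : R).
  have : forall (s : seq 'I_N.+1),
    (0 < \prod_(p <- s) p ^ logn p d)%N /\
    ln (\prod_(p <- s) p ^ logn p d)%:R =
      \sum_(p <- s) ln (p%:R ^+ logn p d) :> R.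
    elim=> [|p s [IH1 IH2]]; first by rewrite !big_nil ln1.
    have p0 : (0 < p ^ logn p d)%N
      by rewrite expn_gt0 lognE; case: (boolP (prime p)) => [/prime_gt0->|_] //; rewrite orbT.
    by rewrite !big_cons muln_gt0 p0 IH1 ln_natM // IH2 natrX.
  by move=> /(_ (index_enum _))[].
rewrite [LHS](bigID (fun p : 'I_N.+1 => prime p)) /= [X in _ + X]big1 ?addr0.
  by apply: eq_bigr => p /prime_gt0 p0; rewrite lnXn ?ltr0n.
by move=> p; rewrite lognE => /negbTE->; rewrite expr0 ln1.
Qed.

(** A prime p contributes ln p once for each exponent from 1 to [logn p d], so this is unique
    factorization. *)
Lemma sum_primepows_dvd d N : (0 < d)%N -> (d <= N)%N ->
  \sum_(u in primepows N | (pw u %| d)%N) ln u.1%:R = ln d%:R :> R.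
Proof.
move=> d0 dN; rewrite (ln_sum_primes _ _ d0 dN).
under eq_bigl => u.
  have -> : (u \in primepows N) && (pw u %| d)%N =
     prime u.1 && ((0 < u.2)%N && (u.2 <= logn u.1 d)%N).
    rewrite inE /pw; case: (boolP (prime u.1)) => //= pu.
    rewrite -(pfactor_dvdn _ pu d0); case: (0 < u.2)%N => //=.
    by case: (boolP (_ %| _)%N) => [/(dvdn_leq d0)/leq_trans->//|]; rewrite andbF.
  over.
rewrite -(pair_big_dep (fun p : 'I_N.+1 => prime p)
  (fun p a : 'I_N.+1 => (0 < a)%N && (a <= logn p d)%N) (fun p _ => ln p%:R)) /=.
apply: eq_bigr => p pp; rewrite sumr_const; congr (_ *+ _).
have lN : (logn p d < N.+1)%N.
  by rewrite ltnS (leq_trans (ltnW (ltn_logl p d0))).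
rewrite -sum1_card.
transitivity (\sum_(a < N.+1 | (0 < a)%N && (a < (logn p d).+1)%N) 1)%N => //.
rewrite -(big_ord_widen_cond N.+1 (fun a => 0 < a)%N (fun=> 1%N)) //.
rewrite big_mkcond big_ord_recl /= (eq_bigr (fun=> 1%N)) //.
by rewrite sum_nat_const card_ord muln1.
Qed.

End PrimePowerSums.

(** * Chebyshev and Mertens type estimates *)

Section Chebyshev.
Context {R : realType}.
Implicit Types N d j m : nat.

(** Legendre's formula for all primes at once: passing from m to m + 1 raises [m %/ q] by one
    exactly when q divides m + 1. *)
Lemma ln_fact m N : (m <= N)%N ->
  ln m`!%:R = \sum_(u in primepows N) ln u.1%:R * (m %/ pw u)%:R :> R.
Proof.
elim: m => [_|m IH mN].
  by rewrite ln1 big1 // => u _; rewrite div0n mulr0.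
rewrite factS ln_natM ?fact_gt0 // (IH (ltnW mN)) -(sum_primepows_dvd m.+1 N) //.
rewrite big_mkcondr -big_split /=; apply: eq_bigr => u /primepowsP[_ _ q0 _].
rewrite divnS // natrD mulrDr; congr (_ + _).
by case: ifP => _; rewrite ?mulr1 ?mulr0.
Qed.

(** Each step multiplies the central binomial coefficient by 2(2m + 1)/(m + 1) >= 2. *)
Lemma expn2_fact m : (2 ^ m * (m`! * m`!) <= (2 * m)`!)%N.
Proof.
elim: m => // m IH.
rewrite mulnS !addSn add0n 2!factS expnS factS.
apply: leq_trans (_ : (2 * m).+2 * (m.+1 * (2 ^ m * (m`! * m`!))) <= _)%N.
  by rewrite leq_eqVlt; apply/orP; left; apply/eqP; ring.
by rewrite !leq_mul2l /= leq_mul //; lia.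
Qed.

Lemma ln2_ge : 2^-1 <= ln 2 :> R.
Proof.
have := @le_ln1Dx R (- 2^-1) ltac:(lra).
rewrite (_ : 1 - 2^-1 = 2^-1); last by field.
by rewrite lnV ?posrE //; lra.
Qed.

Lemma chebyshev_psi_ge y N : (2 <= y)%N -> (y <= N)%N ->
  y%:R / 6 <= \sum_(u in primepows N | (pw u <= y)%N) ln u.1%:R :> R.
Proof.
move=> y2 yN; pose m := (y %/ 2)%N.
(* ln ((2m)! / m!^2) >= m ln 2 is the sum of (2m / q - 2 (m / q)) ln p over the
   prime powers q = p^a, and these coefficients are at most 1. *)
have ym : y%:R <= 3 * m%:R :> R by rewrite -natrM ler_nat /m; lia.
have mN : (2 * m <= N)%N by rewrite /m; lia.
(* The 6 of the statement is the 3 of [ym] times the 2 of [ln2_ge]. *)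
apply: le_trans (_ : m%:R * ln 2 <= _).
  by have m0 : 0 <= m%:R :> R by []; have := ln2_ge; nra.
have := ln_nat_le (R := R) _ _ _ (expn2_fact m).
rewrite !ln_natM ?muln_gt0 ?fact_gt0 ?expn_gt0 // ln_natX //.
move=> /(_ isT); rewrite (ln_fact (2 * m) N) // (ln_fact m N); last by lia.
rewrite -lerBrDr -big_split /= -sumrB mulr_natl => /le_trans; apply.
rewrite big_mkcondr /=; apply: ler_sum => u /primepowsP[pp _ q0 _].
rewrite -mulrDr -mulrBr; have l0 := ln_nat_ge0 (R := R) u.1.
have [le|gt] := leqP (pw u) y.
  rewrite ler_piMr // lerBlDr -natrD -[1]/(1%:R) -natrD ler_nat.
  rewrite -ltnS ltn_divLR //; have := ltn_ceil m q0.
  by move: (m %/ pw u)%N (pw u) => r q; lia.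
by rewrite !divn_small ?addr0 ?subrr ?mulr0 // /m; lia.
Qed.

(** Legendre's formula bounds the sum of [(k %/ p)] ln p by ln k! <= k ln k, and [k %/ p] >= k /
    (2p) for p <= k. *)
Lemma sum_ln_primes_le k : (0 < k)%N ->
  \sum_(p < k.+1 | prime p) ln p%:R / p%:R <= 2 * ln k%:R :> R.
Proof.
move=> k0.
have kk : ln k`!%:R <= k%:R * ln k%:R :> R.
  rewrite mulr_natl -ln_natX // ln_nat_le ?fact_gt0 //.
  by elim: (k) => // -[|j] IH //; rewrite factS expnS leq_mul2l /= (leq_trans IH) // leq_exp2r.
have : \sum_(p < k.+1 | prime p) ln p%:R * (k %/ p)%:R <= ln k`!%:R :> R.
  rewrite (ln_sum_primes _ _ (fact_gt0 k) (leqnn _)).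
  rewrite (big_ord_widen_cond k`!.+1 (fun p => prime p)
    (fun p => ln p%:R * (k %/ p)%:R : R)) ?ltnS ?fact_geq //.
  rewrite big_mkcondr; apply: ler_sum => p pp; rewrite ltnS -[leRHS]mulr_natr.
  case: ifP => [pk|_]; last by rewrite mulr_ge0 ?ln_nat_ge0.
  rewrite ler_wpM2l ?ln_nat_ge0 // ler_nat logn_fact // big_ltn ?ltnS //.
  by rewrite expn1 leq_addr.
move=> /le_trans/(_ kk) h.
have k0' : 0 < k%:R :> R by rewrite ltr0n.
rewrite -(ler_pM2l k0') mulrCA; apply: le_trans (ler_wpM2l (ler0n R 2) h).
rewrite !mulr_sumr; apply: ler_sum => p pp.
have p0 : 0 < p%:R :> R by rewrite ltr0n prime_gt0.
rewrite mulrCA (mulrCA 2) ler_wpM2l ?ln_nat_ge0 // ler_pdivrMr // -!natrM ler_nat.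
have := ltn_ceil k (prime_gt0 pp); have := ltn_ord p; rewrite ltnS => pk.
have : (0 < k %/ p)%N by rewrite divn_gt0 ?prime_gt0.
by nia.
Qed.

Lemma sum_geom_le (x : R) n : 0 <= x -> x <= 2^-1 ->
  \sum_(a < n | (0 < a)%N) x ^+ a <= 2 * x.
Proof.
move=> x0 x2.
(* The tail 2 x^n carries the induction, because 2x <= 1; the empty sum at n = 0 is set apart. *)
suff : \sum_(a < n | (0 < a)%N) x ^+ a + 2 * x ^+ n <= 2 * x \/ n = 0%N.
  by move=> [h|->]; [apply: le_trans h; rewrite lerDl mulr_ge0 ?exprn_ge0 | rewrite big_ord0; lra].
case: n => [|n]; [by right | left]; elim: n => [|n IH].
  by rewrite big_mkcond big_ord_recl big_ord0 /= addr0 add0r expr1.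
apply: le_trans IH; rewrite big_mkcond big_ord_recr /= -big_mkcond /= (exprS _ n.+1).
rewrite -addrA lerD2l; have := exprn_ge0 n.+1 x0; nra.
Qed.

Lemma sum_primepows_small k N : (0 < k)%N ->
  \sum_(u in primepows N | (u.1 <= k)%N) ln u.1%:R / (pw u)%:R <= 4 * ln k%:R :> R.
Proof.
move=> k0.
apply: le_trans (_ : \sum_(u : 'I_N.+1 * 'I_N.+1 |
    (prime u.1 && (u.1 <= k)%N) && (0 < u.2)%N) ln u.1%:R * u.1%:R^-1 ^+ u.2 <= _).
  rewrite [leLHS]big_mkcond [leRHS]big_mkcond; apply: ler_sum => u _ /=.
  rewrite inE; case: (boolP (prime u.1)) => //= pu.
  case: (0 < u.2)%N => //=; last by rewrite andbF.
  case: (u.1 <= k)%N; rewrite ?andbT ?andbF //.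
  case: ifP => _; last by rewrite mulr_ge0 ?ln_nat_ge0 ?exprn_ge0 ?invr_ge0.
  by rewrite /pw natrX exprVn.
rewrite -(pair_big (fun p : 'I_N.+1 => prime p && (p <= k)%N) (fun a : 'I_N.+1 => 0 < a)%N
  (fun p a => ln p%:R * p%:R^-1 ^+ a)) /=.
apply: le_trans (_ : \sum_(p < N.+1 | prime p && (p <= k)%N) 2 * (ln p%:R / p%:R) <= _).
  apply: ler_sum => p /andP[pp _]; rewrite -mulr_sumr mulrCA.
  rewrite ler_wpM2l ?ln_nat_ge0 ?sum_geom_le ?invr_ge0 //.
  by rewrite lef_pV2 ?posrE ?ltr0n ?prime_gt0 // ler_nat prime_gt1.
rewrite -mulr_sumr (_ : 4 = 2 * 2 :> R); last by ring.
rewrite -mulrA ler_wpM2l //; apply: le_trans (sum_ln_primes_le _ k0).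
have [kN|Nk] := leqP k N.
  by rewrite (big_ord_widen_cond N.+1 prime (fun p => ln p%:R / p%:R : R)).
rewrite (big_ord_widen_cond k.+1 (fun p => prime p && (p <= k)%N)
  (fun p => ln p%:R / p%:R : R)) //; last by rewrite ltnS ltnW.
rewrite [leLHS]big_mkcond [leRHS]big_mkcond; apply: ler_sum => p _.
case: prime => //=; case: ifP => // _; rewrite mulr_ge0 ?ln_nat_ge0 ?invr_ge0 //.
Qed.

End Chebyshev.

(** * Harmonic sums and reciprocals of smooth numbers *)

Section SmoothNumbers.
Context {R : realType}.
Implicit Types N d j m : nat.

Lemma ler_sum_inj (I J : finType) (P : pred I) (Q : pred J) (h : I -> J)
    (F : I -> R) (G : J -> R) :
  {in P &, injective h} -> (forall i, P i -> Q (h i) /\ F i <= G (h i)) ->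
  (forall y, Q y -> 0 <= G y) ->
  \sum_(i | P i) F i <= \sum_(y | Q y) G y.
Proof.
move=> hI hP G0; apply: le_trans (_ : \sum_(i in P) G (h i) <= _).
  by apply: ler_sum => i /hP[].
rewrite -(big_imset _ hI) /= [leLHS]big_mkcond [leRHS]big_mkcond.
apply: ler_sum => y _; case: imsetP => [[i Pi ->]|_].
  by have [-> _] := hP _ Pi.
by case: ifP => // /G0.
Qed.

Lemma ln_succ_ge j : (0 < j)%N -> j.+1%:R^-1 <= ln j.+1%:R - ln j%:R :> R.
Proof.
move=> j0; have j0' : 0 < j%:R :> R by rewrite ltr0n.
have j1 : 0 < j.+1%:R :> R by rewrite ltr0n.
have je : j%:R = j.+1%:R - 1 :> R by rewrite -natr1 addrK.
have := @le_ln1Dx R (- j.+1%:R^-1).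
rewrite (_ : 1 - _ = j%:R / j.+1%:R); last by rewrite {1}je mulrBl divff ?gt_eqF // mul1r.
rewrite ln_div ?posrE // => h; rewrite -lerN2 opprB h //.
by rewrite ltrN2 invf_lt1 // ltr1n.
Qed.

Lemma ln_succ_le j : (0 < j)%N -> ln j.+1%:R - ln j%:R <= j%:R^-1 :> R.
Proof.
move=> j0; have j0' : 0 < j%:R :> R by rewrite ltr0n.
rewrite -ln_div ?posrE ?ltr0n // -natr1 mulrDl mul1r divff ?gt_eqF //.
by apply: le_ln1Dx; apply: lt_trans (_ : 0 < _); rewrite ?invr_gt0 // ltrN10.
Qed.

Lemma harmonic_le M N : (0 < M)%N ->
  \sum_(s < N.+1 | (0 < s <= M)%N) s%:R^-1 <= 1 + ln M%:R :> R.
Proof.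
move=> M0.
(* The induction runs on the single cutoff [minn N.+1 M], which starts at 1. *)
suff : \sum_(s < N.+2 | (0 < s <= M)%N) s%:R^-1 <= 1 + ln (minn N.+1 M)%:R :> R.
  rewrite big_mkcond big_ord_recr /= -big_mkcond /= => h.
  apply: le_trans (_ : 1 + ln (minn N.+1 M)%:R <= _); last first.
    by rewrite lerD2l ln_nat_le ?leq_min ?geq_minr.
  by apply: le_trans h; rewrite lerDl; case: ifP => // _; rewrite invr_ge0.
elim: N => [|N IH].
  rewrite big_mkcond big_ord_recr big_ord_recl big_ord0 /= M0 /= invr1.
  by rewrite (minn_idPl _) // ln1 !add0r addr0.
rewrite big_mkcond big_ord_recr /= -big_mkcond /=; case: ifP => NM.
  move: IH; rewrite !(minn_idPl _) // ?(ltnW NM) // => IH.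
  apply: le_trans (lerD IH (ln_succ_ge N.+1 isT)) _.
  by rewrite -addrA (addrCA (ln N.+1%:R)) subrr addr0.
move: IH; rewrite addr0 !(minn_idPr _) //; lia.
Qed.

Lemma harmonic_ge N : ln N.+1%:R <= \sum_(s < N.+1 | (0 < s)%N) s%:R^-1 :> R.
Proof.
elim: N => [|N IH]; first by rewrite ln1 sumr_ge0 // => s _; rewrite invr_ge0.
rewrite big_mkcond big_ord_recr /= -big_mkcond /=.
by apply: le_trans (lerD IH (ln_succ_le N.+1 isT)); rewrite addrCA subrr addr0.
Qed.

(* (primes_ge k).-nat d means that d is k-rough, (primes_ge k)^'.-nat s that s
   is k-smooth; both exclude 0. *)
Definition primes_ge (k : nat) : nat_pred := [pred p | (k <= p)%N].

(** Dividing by q maps these s injectively to [pi]-numbers. *)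
Lemma sum_dvd_smooth_le (pi : nat_pred) q N : (0 < q)%N ->
  \sum_(s < N.+1 | pi.-nat s && (q %| s)%N) s%:R^-1 <=
  q%:R^-1 * \sum_(s < N.+1 | pi.-nat s) s%:R^-1 :> R.
Proof.
move=> q0; rewrite mulr_sumr.
have dK (s : 'I_N.+1) : (q %| s)%N -> (q * (inord (s %/ q) : 'I_N.+1))%N = s.
  move=> qs; rewrite inordK; first by rewrite mulnC divnK.
  by rewrite ltnS (leq_trans (leq_div _ _)) // -ltnS.
apply: (@ler_sum_inj _ _ _ _ (fun s : 'I_N.+1 => inord (s %/ q) : 'I_N.+1)).
- move=> s t /andP[_ /dK sq] /andP[_ /dK tq] e.
  by apply: val_inj; rewrite /= -sq -tq e.
- move=> s /andP[ps /dK e]; move: ps; rewrite -{1 3}e pnatM => /andP[_ ->].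
  by split=> //; rewrite natrM invfM.
- by move=> s _; rewrite mulr_ge0 ?invr_ge0.
Qed.

(* A variant of Rankin's trick: the sum of (8 ln k - ln s) / s is at least half
   of the sum of 8 ln k / s, while only the terms with s <= k^8 contribute
   positively to it. *)
Lemma sum_smooth_le k N : (1 < k)%N ->
  \sum_(s < N.+1 | (primes_ge k)^'.-nat s) s%:R^-1 <= 20 * ln k%:R :> R.
Proof.
move=> k1; set S := \sum_(s < _ | _) _; set l := ln k%:R.
have k0 : (0 < k)%N by lia.
have l0 : 2^-1 <= l by apply: le_trans ln2_ge _; rewrite ln_nat_le.
have S0 : 0 <= S by apply: sumr_ge0 => s _; rewrite invr_ge0.
(* Expand ln s over the prime powers q dividing s, whose primes are below k, and exchange: each q
   leaves at most S / q. *)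
have LS : \sum_(s < N.+1 | (primes_ge k)^'.-nat s) ln s%:R / s%:R <= 4 * l * S.
  apply: le_trans (_ : \sum_(s < N.+1 | (primes_ge k)^'.-nat s)
    \sum_(u in primepows N | (pw u %| s)%N) ln u.1%:R / s%:R <= _).
    apply: ler_sum => s /andP[s0 _]; rewrite -mulr_suml sum_primepows_dvd //.
    by rewrite -ltnS.
  rewrite (exchange_big_dep (fun u => (u \in primepows N) && (u.1 <= k)%N)) /=; last first.
    move=> s u ps /andP[uN us]; rewrite uN /=.
    have [pp a0 _ _] := primepowsP _ _ uN.
    have := pnat_dvd us ps; rewrite /pw pnatX pnatE // orbC.
    by rewrite eqn0Ngt a0 /= !inE -ltnNge => /ltnW.
  apply: le_trans (ler_wpM2r S0 (sum_primepows_small k N k0)).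
  rewrite mulr_suml; apply: ler_sum => u /andP[uN uk].
  have [pp a0 q0 _] := primepowsP _ _ uN.
  rewrite -mulrA -mulr_sumr ler_wpM2l ?ln_nat_ge0 //.
  apply: le_trans (sum_dvd_smooth_le (primes_ge k)^' _ N q0).
  by rewrite le_eqVlt; apply/orP; left; apply/eqP/eq_bigl => s; rewrite uN.
have HS : \sum_(s < N.+1 | (primes_ge k)^'.-nat s) (8 * l - ln s%:R) / s%:R <=
    8 * l * (1 + 8 * l).
  apply: le_trans (_ : \sum_(s < N.+1 | (0 < s <= k ^ 8)%N) 8 * l / s%:R <= _).
    rewrite [leLHS]big_mkcond [leRHS]big_mkcond; apply: ler_sum => s _.
    have lk : ln (k ^ 8)%:R = 8 * l :> R by rewrite ln_natX // mulr_natl.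
    case: ifP => [/andP[s0 _]|_].
      rewrite s0 /=; case: leqP => sk.
        by rewrite ler_pM2r ?invr_gt0 ?ltr0n // gerBl ln_nat_ge0.
      rewrite pmulr_lle0 ?invr_gt0 ?ltr0n // subr_le0 -lk.
      by rewrite ln_nat_le ?expn_gt0 ?k0 // ltnW.
    by case: ifP => // _; rewrite mulr_ge0 ?invr_ge0 //; lra.
  rewrite -mulr_sumr ler_wpM2l //; first lra.
  apply: le_trans (harmonic_le _ N _) _; rewrite ?expn_gt0 ?k0 //.
  by rewrite ln_natX // mulr_natl.
(* With [LS] this gives 4 l S <= 8 l (1 + 8 l), so S <= 2 + 16 l <= 20 l as l >= 1/2. *)
move: HS; under eq_bigr do rewrite mulrBl.
rewrite sumrB -mulr_sumr -/S; nra.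
Qed.

End SmoothNumbers.

(** * Splitting off prime factors below k *)

Section RoughNumbers.
Context {R : realType}.

(** Each positive j <= N is the product of its [pi]-part and its [pi^']-part, so 1/j occurs in the
    expanded product. *)
Lemma ln_le_sum_part (pi : nat_pred) N :
  ln N.+1%:R <= (\sum_(m < N.+1 | pi.-nat m) m%:R^-1) *
                (\sum_(s < N.+1 | pi^'.-nat s) s%:R^-1) :> R.
Proof.
apply: le_trans (harmonic_ge N) _; rewrite big_distrlr /=.
rewrite (pair_big (fun m : 'I_N.+1 => pi.-nat m) (fun s : 'I_N.+1 => pi^'.-nat s)
  (fun m s : 'I_N.+1 => m%:R^-1 * s%:R^-1 : R)).
have partK (rho : nat_pred) (j : 'I_N.+1) : (0 < j)%N ->
    (inord (partn j rho) : 'I_N.+1) = (partn j rho) :> nat.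
  move=> j0; rewrite inordK // (leq_ltn_trans (dvdn_leq j0 (dvdn_part _ _))) //.
apply: (@ler_sum_inj _ _ _ _ _
  (fun j : 'I_N.+1 => (inord (partn j pi) : 'I_N.+1, inord (partn j pi^') : 'I_N.+1))).
- move=> i j i0 j0 [/(congr1 val) /= e1 /(congr1 val) /= e2]; apply: val_inj => /=.
  by rewrite -(partnC pi i0) -(partnC pi j0) -(partK pi i i0) -(partK pi^' i i0) e1 e2 !partK.
- move=> j j0 /=; rewrite !partK // !part_pnat; split=> //.
  by rewrite -invfM -natrM partnC.
- by move=> [m s] _; rewrite mulr_ge0 ?invr_ge0.
Qed.

(** The powers of p up to y all divide the largest of them, to which [sum_primepows_dvd] applies. *)
Lemma sum_primepows_base_le p y N : (0 < y)%N -> (y <= N)%N ->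
  \sum_(u in primepows N | (pw u <= y)%N && (u.1 == p :> nat)) ln u.1%:R <=
  ln y%:R :> R.
Proof.
move=> y0 yN; have [pp|pnp] := boolP (prime p); last first.
  rewrite big1 ?ln_nat_ge0 // => u /andP[/primepowsP[pu _ _ _] /andP[_ /eqP e]].
  by rewrite -e pu in pnp.
have Py : (p ^ trunc_log p y <= y)%N by rewrite trunc_logP ?prime_gt1.
have P0 : (0 < p ^ trunc_log p y)%N by rewrite expn_gt0 prime_gt0.
apply: le_trans (ln_nat_le _ _ P0 Py).
rewrite -(sum_primepows_dvd _ N) ?(leq_trans Py) //.
rewrite [leLHS]big_mkcond [leRHS]big_mkcond; apply: ler_sum => u _.
case: (u \in primepows N) => //=; case: andP => [[uy /eqP e]|_].
  by rewrite ifT // /pw e dvdn_exp2l // trunc_log_max ?prime_gt1 // -e.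
by case: ifP => //; rewrite ln_nat_ge0.
Qed.

(** Of the y / 6 from Chebyshev's bound, the primes below k account for at most k ln y <= y / 12. *)
Lemma sum_primepows_ge k y N : (0 < k)%N -> ((24 * k) ^ 2 <= y)%N -> (y <= N)%N ->
  y%:R / 12 <=
  \sum_(u in primepows N | (k <= u.1)%N && (pw u <= y)%N) ln u.1%:R :> R.
Proof.
move=> k0 ky yN; have y2 : (2 <= y)%N by nia.
have kN : (k <= N)%N by nia.
have psi := chebyshev_psi_ge (R := R) _ _ y2 yN.
have small : \sum_(u in primepows N | ~~ (k <= u.1)%N && (pw u <= y)%N) ln u.1%:R
    <= k%:R * ln y%:R :> R.
  rewrite (partition_big (fun u => u.1) (fun p : 'I_N.+1 => p < k)%N) /=; last first.
    by move=> u /and3P[_]; rewrite ltnNge.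
  apply: le_trans (_ : \sum_(p < N.+1 | (p < k)%N) ln y%:R <= _); last first.
    by rewrite -(big_ord_widen N.+1 (fun=> ln y%:R)) ?sumr_const ?card_ord ?mulr_natl // ltnW.
  apply: ler_sum => p _; apply: le_trans (sum_primepows_base_le p _ _ _ yN); last by lia.
  rewrite [leLHS]big_mkcond [leRHS]big_mkcond; apply: ler_sum => u _.
  case: (u \in primepows N) => //=; case: (pw u <= y)%N; rewrite ?andbT ?andbF //= -val_eqE.
  by case: eqP; case: leqP; rewrite ?ln_nat_ge0 //=.
(* With s the square root of y: ln y = 2 ln s <= 2 s and k <= s / 24. *)
have kly : k%:R * ln y%:R <= y%:R / 12 :> R.
  have y0 : 0 <= y%:R :> R by [].
  set s := Num.sqrt (y%:R : R); have sy : s ^+ 2 = y%:R by rewrite sqr_sqrtr.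
  have s24 : 24 * k%:R <= s.
    by rewrite -(@ler_pXn2r _ 2) ?nnegrE ?sqrtr_ge0 ?mulr_ge0 // sy -natrM -natrX ler_nat.
  have k0' : 0 < k%:R :> R by rewrite ltr0n.
  have s0 : 0 < s by lra.
  have := ln_sublinear s0; rewrite -sy lnXn // => ls.
  rewrite -mulr_natl; nra.
apply: le_trans (_ : y%:R / 6 - k%:R * ln y%:R <= _); first by lra.
rewrite lerBlDr; apply: le_trans psi _; apply: le_trans (lerD (lexx _) small).
rewrite [leLHS](bigID (fun u : 'I_N.+1 * 'I_N.+1 => k <= u.1)%N) /= lerD //.
  by under eq_bigl do rewrite -andbA (andbC (_ <= y)%N).
by under eq_bigl do rewrite -andbA (andbC (_ <= y)%N).
Qed.

End RoughNumbers.

(** * Counting rough numbers *)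

Section RoughCount.
Context {R : realType}.

(** The sum of ln d over rough d is at most their number times ln N; from below it is estimated
    through factorizations d = m q with q a power of a prime >= k. *)
Lemma card_rough_ge k N : (1 < k)%N -> (k ^ 24 <= N)%N ->
  N%:R <= 960 * ln k%:R * #|[set d : 'I_N.+1 | (primes_ge k).-nat d]|%:R :> R.
Proof.
move=> k1 kN; set Phi := #|_|; set pi := primes_ge k.
pose X := (N %/ k ^ 12)%N.
have k12 : (0 < k ^ 12)%N by rewrite expn_gt0; lia.
have kk : (k ^ 24 = k ^ 12 * k ^ 12)%N by rewrite -expnD.
have XN : (X <= N)%N by exact: leq_div.
have N0 : (1 < N)%N by apply: leq_trans kN; apply: leq_trans (_ : k ^ 1 <= _)%N; rewrite ?leq_exp2l.
(* N k^24 <= N^2 <= ((X + 1) k^12)^2, so N <= (X + 1)^2; hence the exponent 24, twice 12. *)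
have NX : ln N%:R <= 2 * ln X.+1%:R :> R.
  rewrite mulr_natl -ln_natX // ln_nat_le //; first by lia.
  have := ltn_ceil N k12; rewrite -/X => h.
  rewrite -(@leq_pmul2r (k ^ 24)); last by rewrite expn_gt0 (ltnW k1).
  apply: leq_trans (_ : N * N <= _)%N; first by rewrite leq_mul2l kN orbT.
  by rewrite kk expnS expn1 mulnACA leq_mul // ltnW.
have step1 : \sum_(d < N.+1 | pi.-nat d)
    \sum_(u in primepows N | (pw u %| d)%N) ln u.1%:R <= Phi%:R * ln N%:R :> R.
  rewrite mulr_natl /Phi -sumr_const.
  rewrite [leRHS](eq_bigl (fun d : 'I_N.+1 => pi.-nat d)); last by move=> d; rewrite inE.
  apply: ler_sum => d /andP[d0 _]; have dN : (d <= N)%N by rewrite -ltnS.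
  by rewrite sum_primepows_dvd // ln_nat_le.
(* A pair (m, q) goes to the divisor q of the rough number d = m q; d and q determine m. *)
have step2 : \sum_(m < N.+1 | pi.-nat m && (m <= X)%N)
    \sum_(u in primepows N | (k <= u.1)%N && (pw u <= N %/ m)%N) ln u.1%:R
  <= \sum_(d < N.+1 | pi.-nat d)
    \sum_(u in primepows N | (pw u %| d)%N) ln u.1%:R :> R.
  rewrite !pair_big_dep /=.
  have mulN (m : 'I_N.+1) (u : 'I_N.+1 * 'I_N.+1) : pi.-nat m -> (pw u <= N %/ m)%N ->
      (inord (m * pw u) : 'I_N.+1) = (m * pw u)%N :> nat.
    move=> /andP[m0 _] le; rewrite inordK // ltnS mulnC -leq_divRL //.
  apply: (@ler_sum_inj _ _ _ _ _ (fun mu : 'I_N.+1 * ('I_N.+1 * 'I_N.+1) =>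
    (inord (mu.1 * pw mu.2) : 'I_N.+1, mu.2))).
  - move=> [m u] [m' u'] /= /and3P[/andP[pm _] uN /andP[_ um]].
    move=> /and3P[/andP[pm' _] uN' /andP[_ um']] [e1 e2]; rewrite -e2 in um' e1 *.
    congr (_, _); apply: val_inj => /=; have [_ _ q0 _] := primepowsP _ _ uN.
    have E := mulN _ _ pm um; have E' := mulN _ _ pm' um'.
    by apply/eqP; rewrite -(eqn_pmul2r q0) -E -E' e1.
  - move=> [m u] /= /and3P[/andP[pm _] uN /andP[uk um]]; split=> //.
    have [pp a0 q0 _] := primepowsP _ _ uN.
    by rewrite mulN // uN dvdn_mull // pnatM pm /pw pnatX pnatE // inE uk.
  - by move=> [m u] _; rewrite ln_nat_ge0.
(* Here [N %/ m] >= k^12 >= (24 k)^2, since 2^10 >= 24^2, and [N %/ m] >= N / (2m) turns 1/12 into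
   1/24. *)
have step3 : N%:R / 24 * (\sum_(m < X.+1 | pi.-nat m) m%:R^-1) <=
  \sum_(m < N.+1 | pi.-nat m && (m <= X)%N)
    \sum_(u in primepows N | (k <= u.1)%N && (pw u <= N %/ m)%N) ln u.1%:R :> R.
  rewrite (big_ord_widen_cond N.+1 (fun m => pi.-nat m) (fun m => m%:R^-1 : R)) //.
  rewrite mulr_sumr; apply: ler_sum => m /andP[/andP[m0 _] mX].
  have mkN : (m * k ^ 12 <= N)%N by rewrite -leq_divRL.
  have mN : (m <= N)%N by rewrite -ltnS.
  have le : (k ^ 12 <= N %/ m)%N by rewrite leq_divRL // mulnC.
  apply: le_trans (sum_primepows_ge k (N %/ m) N _ _ _); rewrite ?leq_div //; last 2 first.
  - exact: leq_trans k1.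
  - apply: leq_trans le; rewrite expnMn (expnD k 2 10) mulnC leq_mul2l.
    by apply/orP; right; apply: leq_trans (_ : 2 ^ 10 <= _)%N => //; rewrite leq_exp2r.
  have : (N <= 2 * (N %/ m * m))%N.
    apply: leq_trans (ltnW (ltn_ceil N m0)) _; rewrite mulnA leq_mul2r mul2n -addnn.
    by rewrite -[ltnLHS]addn0 ltn_add2l divn_gt0 // mN orbT.
  have m0' : 0 < m%:R :> R by rewrite ltr0n.
  rewrite -(ler_nat R) !natrM => Nm; rewrite ler_pdivrMr //; lra.
have part := ln_le_sum_part (R := R) pi X.
have smooth := sum_smooth_le (R := R) k X k1.
have lN : 0 < ln N%:R :> R by rewrite ln_gt0 // ltr1n.
set Q := \sum_(m < X.+1 | _) _ in step3 part.
have Q0 : 0 <= Q by apply: sumr_ge0 => m _; rewrite invr_ge0.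
(* 960 = 24 * 20 * 2, from [step3], [smooth] and [NX]. *)
have := le_trans (le_trans step3 step2) step1.
have := le_trans part (ler_wpM2l Q0 smooth).
have lk : 0 < ln k%:R :> R by rewrite ln_gt0 // ltr1n.
move: NX lN lk Q0 (ler0n R N) (ler0n R Phi).
move: (ln N%:R : R) (ln X.+1%:R : R) (ln k%:R : R) (N%:R : R) (Phi%:R : R) => a b c x f.
move=> ab a0 c0 Q0 x0 f0 bQ h.
rewrite -(ler_pM2r a0).
have h1 : x * (b * 24^-1) <= x * (Q * (20 * c) * 24^-1) by rewrite ler_wpM2l //; lra.
have h2 := ler_wpM2r (ltW c0) h.
have h3 := ler_wpM2l x0 ab.
lra.
Qed.

End RoughCount.

(** * Double counting of spoiled progressions *)

Section WeightedProgressions.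
Context {R : realType}.

(** Ordinals are 0-based, and terms that reach n are dropped; [ap_set_is_ap] bounds the last term to
    exclude this. *)
Definition ap_set {n : nat} (k a d : nat) : {set 'I_n} :=
  [set v : 'I_n | [exists i : 'I_k, v == a + i * d :> nat]%N].

Lemma ap_setP {n k a d : nat} (v : 'I_n) :
  reflect (exists2 i, (i < k)%N & v = a + i * d :> nat)%N (v \in ap_set k a d).
Proof.
rewrite inE; apply: (iffP existsP) => [[i /eqP e]|[i ik e]]; first by exists i.
by exists (Ordinal ik); apply/eqP.
Qed.

Lemma ap_set_is_ap {n k a d : nat} : (0 < d)%N -> (a + k.-1 * d < n)%N ->
  is_ap k (ap_set k a d : {set 'I_n}).
Proof.
move=> d0 an; exists a.+1, d; split=> // x; apply/imageP/mapP.
  move=> [v /ap_setP[i ik e] ->]; exists i; first by rewrite mem_iota.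
  by rewrite /label e addSn.
move=> [i]; rewrite mem_iota /= add0n => ik ->.
have vn : (a + i * d < n)%N.
  apply: leq_ltn_trans an; rewrite leq_add2l leq_mul2r; apply/orP; right.
  by rewrite -ltnS (leq_trans ik) // leqSpred.
by exists (Ordinal vn); [apply/ap_setP; exists i | rewrite /label addSn].
Qed.

(** A start a whose progression contains x is x - j d for one of k values of j. *)
Lemma card_starts_le {n k d M : nat} (x : 'I_n) :
  (#|[set a : 'I_M | x \in ap_set k a d]| <= k)%N.
Proof.
set A := [set _ | _].
rewrite cardE -(size_map val) -[leqRHS](size_iota 0) -[leqRHS](size_map (fun j => x - j * d)%N).
apply: uniq_leq_size; first by rewrite (map_inj_uniq val_inj) enum_uniq.
move=> _ /mapP[a + ->]; rewrite mem_enum inE => /ap_setP[j jk e].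
by apply/mapP; exists j; rewrite ?mem_iota // e addnK.
Qed.

Definition oriented_edges {n : nat} (G : sgraph 'I_n) : {set 'I_n * 'I_n} :=
  [set e : 'I_n * 'I_n | (e.1 < e.2)%N && adj G e.1 e.2].

Lemma card_oriented_edges_le {n : nat} (G : sgraph 'I_n) :
  (#|oriented_edges G| <= #|edges G|)%N.
Proof.
have fI : {in oriented_edges G &, injective (fun e : 'I_n * 'I_n => [set e.1; e.2])}.
  move=> [x y] [x' y']; rewrite !inE /= => /andP[xy _] /andP[xy' _] e.
  have : x \in [set x'; y'] by rewrite -e set21.
  have : y \in [set x'; y'] by rewrite -e set22.
  have : x' \in [set x; y] by rewrite e set21.
  rewrite !inE -!val_eqE /= => h1 h2 h3; congr (_, _); apply: val_inj => /=; lia.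
rewrite -(card_in_imset fI); apply/subset_leq_card/subsetP => _ /imsetP[[x y] + ->].
rewrite !inE /= => /andP[_ xy]; apply/existsP; exists x; apply/existsP; exists y.
by rewrite xy eqxx.
Qed.

(** If every pair (a, i) were spoiled, charging it to an edge would give at most k [mu] per edge:
    [mu] bounds the weight of the i compatible with the edge's difference D, and each such i has at
    most k starts. The first [n - k.-1 * T] starts fit every difference up to T. *)
Lemma independent_ap_of_weights {n k T : nat} (G : sgraph 'I_n) (I : finType)
    (P : pred I) (delta : I -> nat) (w : I -> R) (mu : R) :
  (forall i, P i -> (0 < delta i <= T)%N) -> (forall i, P i -> 0 <= w i) ->
  0 <= mu ->
  (forall D, (0 < D < n)%N ->
    \sum_(i | [&& P i, (delta i %| D)%N & (D < k * delta i)%N]) w i <= mu) ->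
  #|edges G|%:R * (k%:R * mu) < (n - k.-1 * T)%:R * \sum_(i | P i) w i ->
  exists S : {set 'I_n}, is_ap k S /\ independent G S.
Proof.
move=> dP w0 mu0 hmu; set M := (n - k.-1 * T)%N => lt.
pose good (a : 'I_M) i :=
  [forall x in ap_set k a (delta i), forall y in ap_set k a (delta i), ~~ adj G x y].
have [/existsP[a /existsP[i /andP[Pi /forall_inP g]]]|bad] :=
    boolP [exists a : 'I_M, exists i, P i && good a i].
  have /andP[d0 dT] := dP i Pi.
  exists (ap_set k a (delta i)); split; last first.
    by move=> x y xS yS; exact: (forall_inP (g x xS)).
  apply: ap_set_is_ap => //; rewrite addnC -ltn_subRL.
  by apply: leq_trans (ltn_ord a) _; rewrite leq_sub2l // leq_mul.
exfalso; move: lt; rewrite ltNge => /negP; apply.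
pose hit (a : 'I_M) (i : I) (e : 'I_n * 'I_n) :=
  (e.1 \in ap_set k a (delta i)) && (e.2 \in ap_set k a (delta i)).
have badP (a : 'I_M) i : P i -> exists2 e, e \in oriented_edges G & hit a i e.
  move=> Pi; move: bad => /existsPn/(_ a)/existsPn/(_ i); rewrite Pi /=.
  move=> /forall_inPn[x xS] /forall_inPn[y yS]; rewrite negbK => xy.
  case: (ltngtP x y) => [lt|gt|/val_inj e].
  - by exists (x, y); rewrite ?inE /hit /= ?lt ?xS.
  - by exists (y, x); rewrite ?inE /hit /= ?gt 1?adj_sym ?xS ?yS.
  - by rewrite e adj_irr in xy.
apply: le_trans (_ : \sum_(e in oriented_edges G) \sum_(a < M)
  \sum_(i | P i && hit a i e) w i <= _).
  rewrite exchange_big /= mulr_natl -[M in _ *+ M]card_ord -sumr_const.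
  apply: ler_sum => a _.
  rewrite (exchange_big_dep P) /=; last by move=> e i _ /andP[].
  apply: ler_sum => i Pi; have [e eG ha] := badP a i Pi.
  rewrite (bigD1 e) /=; last by rewrite eG Pi ha.
  by rewrite lerDl sumr_ge0 // => *; apply: w0.
apply: le_trans (_ : \sum_(e in oriented_edges G) k%:R * mu <= _); last first.
  rewrite sumr_const -[leLHS]mulr_natl ler_wpM2r ?mulr_ge0 // ler_nat.
  exact: card_oriented_edges_le.
apply: ler_sum => -[x y]; rewrite inE /= => /andP[xy _].
have D0n : (0 < y - x < n)%N by have := ltn_ord y; lia.
apply: le_trans (ler_wpM2l (ler0n R k) (hmu _ D0n)).
rewrite mulr_sumr.
(* Two terms differ by (l - j) d with j, l < k, so the edge spoils only i satisfying [Q]. *)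
pose Q i := [&& P i, (delta i %| y - x)%N & (y - x < k * delta i)%N].
rewrite (exchange_big_dep Q) /=; last first.
  move=> a i _ /andP[Pi /andP[/ap_setP[j jk /= ex] /ap_setP[l lk /= ey]]].
  have /andP[d0 _] := dP i Pi.
  rewrite /Q Pi ex ey subnDl -mulnBl dvdn_mull //= ltn_mul2r d0 /=; lia.
apply: ler_sum => i /andP[Pi _].
apply: le_trans (_ : \sum_(a in [set a : 'I_M | x \in ap_set k a (delta i)]) w i <= _).
  rewrite [leLHS]big_mkcond [leRHS]big_mkcond; apply: ler_sum => a _.
  rewrite Pi /hit inE /=; case: (x \in _) => //=; case: ifP => // _; exact: w0.
by rewrite sumr_const -[leLHS]mulr_natl ler_wpM2r ?w0 // ler_nat card_starts_le.
Qed.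

End WeightedProgressions.

(** * Three choices of weighted differences *)

Section DifferenceFamilies.
Context {R : realType}.

(** All prime factors of m are below k, so the rough part of m d is d. *)
Lemma rough_divisor_eq k d m : (0 < d)%N -> (primes_ge k).-nat d ->
  (0 < m < k)%N -> d = partn (m * d) (primes_ge k).
Proof.
move=> d0 dk /andP[m0 mk]; rewrite partnM // (part_pnat_id dk) part_p'nat ?mul1n //.
apply/pnatP => // p pp pm; rewrite !inE -ltnNge.
exact: leq_ltn_trans (dvdn_leq m0 pm) mk.
Qed.

(** Unit weights with [mu] = 1: only the rough part of D can be a compatible difference. *)
Lemma independent_ap_rough {n k T : nat} (G : sgraph 'I_n) :
  #|edges G|%:R * k%:R <
    (n - k.-1 * T)%:R * #|[set d : 'I_T.+1 | (primes_ge k).-nat d]|%:R :> R ->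
  exists S : {set 'I_n}, is_ap k S /\ independent G S.
Proof.
move=> lt; apply: (@independent_ap_of_weights R n k T G 'I_T.+1
  (fun d => (primes_ge k).-nat d) val (fun=> 1) 1) => //.
- by move=> d /andP[-> _] /=; rewrite -ltnS.
- move=> D /andP[D0 _]; rewrite sumr_const lern1.
  apply/card_le1_eqP => d e; rewrite !unfold_in.
  have h (f : 'I_T.+1) : [&& (primes_ge k).-nat f, (f %| D)%N & (D < k * f)%N] ->
      f = partn D (primes_ge k) :> nat.
    move=> /and3P[fk /dvdnP[m Dm] Dk]; have /andP[f0 _] := fk.
    rewrite {1}(rough_divisor_eq k f m) ?Dm //; move: Dk D0; rewrite Dm.
    by rewrite ltn_pmul2r // muln_gt0 => -> /andP[->].
  by move=> /h hd /h he; apply: val_inj; rewrite /= hd he.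
- rewrite mulr1; apply: lt_le_trans lt _; rewrite ler_wpM2l // -sumr_const.
  by rewrite le_eqVlt; apply/orP; left; apply/eqP/eq_bigl => d; rewrite inE.
Qed.

(** Von Mangoldt weights with [mu] = ln n: the prime powers dividing D weigh ln D in total. *)
Lemma independent_ap_primepows {n k T : nat} (G : sgraph 'I_n) :
  (2 <= T)%N -> (T <= n)%N ->
  #|edges G|%:R * (k%:R * ln n%:R) < (n - k.-1 * T)%:R * (T%:R / 6) :> R ->
  exists S : {set 'I_n}, is_ap k S /\ independent G S.
Proof.
move=> T2 Tn lt; apply: (@independent_ap_of_weights R n k T G _
  (fun u : 'I_n.+1 * 'I_n.+1 => (u \in primepows n) && (pw u <= T)%N) pw
  (fun u => ln u.1%:R) (ln n%:R)).
- by move=> u /andP[/primepowsP[_ _ -> _] ->].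
- by move=> u _; exact: ln_nat_ge0.
- exact: ln_nat_ge0.
- move=> D /andP[D0 Dn]; apply: le_trans (ln_nat_le _ _ D0 (ltnW Dn)).
  rewrite -(sum_primepows_dvd D n) ?(ltnW Dn) //.
  rewrite [leLHS]big_mkcond [leRHS]big_mkcond; apply: ler_sum => u _.
  case: (u \in primepows n) => //=; case: (pw u %| D)%N; rewrite ?andbF //=.
  by case: ifP; rewrite ?ln_nat_ge0.
- by apply: lt_le_trans lt _; rewrite ler_wpM2l // chebyshev_psi_ge.
Qed.

(** Difference 1 alone: the edge side vanishes and n - k + 1 > 0 starts remain. *)
Lemma independent_ap_edgeless {n k : nat} (G : sgraph 'I_n) :
  (0 < k <= n)%N -> #|edges G| = 0%N ->
  exists S : {set 'I_n}, is_ap k S /\ independent G S.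
Proof.
move=> kn E0; apply: (@independent_ap_of_weights R n k 1 G 'I_1
  predT (fun=> 1%N) (fun=> 1) 1) => //.
  move=> D _; apply: le_trans (_ : \sum_(i < 1) 1 <= _); last by rewrite big_ord1.
  by rewrite [leLHS]big_mkcond ler_sum // => i _; case: ifP.
by rewrite E0 mul0r big_ord1 mulr1 ltr0n; lia.
Qed.

End DifferenceFamilies.

(** * The constant and the ranges of [T] *)

Theorem theorem2 (R : realType) :
  exists2 eps : R, 0 < eps &
    forall (n k : nat) (G : sgraph 'I_n),
      (2 <= k)%N -> (k <= n)%N ->
      #|edges G|%:R < eps * (n%:R ^+ 2 / (k%:R ^+ 2 * ln k%:R)) ->
      exists S : {set 'I_n}, is_ap k S /\ independent G S.
Proof.
have half (m z : nat) : (2 * z <= m)%N -> (m <= 2 * (m - z))%N by lia.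
have third (t : nat) : (2 <= t)%N -> (2 * t.+1 <= 3 * t)%N by lia.
(* 6000 = 6 * 1000: [nn] costs the 6, and 1000 exceeds both the 960 of [card_rough_ge] and 26 *
   6. *)
exists 6000^-1; first lra.
move=> n k G k2 kn.
have k0 : 0 < k%:R :> R by rewrite ltr0n ltnW.
have l2 : 2^-1 <= ln k%:R :> R by apply: le_trans ln2_ge _; rewrite ln_nat_le.
have l0 : 0 < ln k%:R :> R by lra.
rewrite mulrA ltr_pdivlMr ?mulr_gt0 ?exprn_gt0 // => Elt.
pose T := (n %/ (2 * k))%N; pose M := (n - k.-1 * T)%N.
have k1 : (0 < k)%N by exact: ltnW.
have nT : (n < T.+1 * (2 * k))%N by rewrite ltn_ceil // muln_gt0.
have Tn : (T * (2 * k) <= n)%N by rewrite leq_trunc_div.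
have E0 : 0 <= #|edges G|%:R :> R by [].
have n0 : 0 <= n%:R :> R by [].
have [T2|T2] := ltnP T 2.
  (* Here n < 4k, so there are fewer than 16 / (6000 ln k) < 1 edges. *)
  apply: (independent_ap_edgeless (R := R)); first by rewrite k1.
  apply/eqP; rewrite -leqn0 -ltnS -(ltr_nat R).
  have nk : n%:R <= 4 * k%:R :> R.
    rewrite -natrM ler_nat; apply: leq_trans (ltnW nT) _.
    by apply: leq_trans (leq_mul T2 (leqnn _)) _; rewrite mulnA.
  have nk2 : n%:R ^+ 2 <= 16 * k%:R ^+ 2 :> R by nra.
  have kk : 0 < k%:R ^+ 2 :> R by rewrite exprn_gt0.
  rewrite -(ltr_pM2r (mulr_gt0 kk l0)) mul1r; apply: lt_le_trans Elt _; nra.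
have nM : n%:R <= 2 * M%:R :> R.
  have : (2 * (k.-1 * T) <= n)%N.
    apply: leq_trans Tn; rewrite (mulnCA T) (mulnC T).
    by rewrite leq_mul2l leq_mul2r leq_pred orbT.
  by rewrite -natrM ler_nat; exact: half.
(* n < 2k (T + 1) <= 3k T as T >= 2. *)
have nkT : n%:R <= 3 * k%:R * T%:R :> R.
  rewrite -!natrM ler_nat; apply: leq_trans (ltnW nT) _.
  by rewrite mulnA (mulnC T.+1) (mulnAC 3) leq_mul2r third ?orbT.
have M0 : 0 <= M%:R :> R by [].
have T0 : 0 <= T%:R :> R by [].
have nn : n%:R ^+ 2 <= 6 * k%:R * (M%:R * T%:R) :> R.
  by rewrite expr2; apply: le_trans (ler_pM n0 n0 nM nkT) _; lra.
have Ek : #|edges G|%:R * k%:R * ln k%:R < 1000^-1 * (M%:R * T%:R) :> R.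
  rewrite -(ltr_pM2r k0); apply: le_lt_trans (lt_le_trans Elt _); lra.
have [Tk|kT] := ltnP T (k ^ 24).
  apply: (@independent_ap_primepows R n k T) => //; first exact: leq_div.
  (* n < 2k (T + 1) <= k^2 k^24. *)
  have ln26 : ln n%:R <= 26 * ln k%:R :> R.
    rewrite mulr_natl -ln_natX ?ln_nat_le ?(leq_trans k1) //.
    by apply: leq_trans (ltnW nT) _; rewrite (expnD k 24 2) leq_mul // expnS expn1 leq_mul2r k2 orbT.
  rewrite -/M mulrA.
  have := ler_wpM2l (mulr_ge0 E0 (ltW k0)) ln26; nra.
apply: (@independent_ap_rough R n k T).
rewrite -/M -(ltr_pM2r l0); apply: lt_le_trans Ek _.
have Ml0 : 0 <= M%:R * ln k%:R * #|[set d : 'I_T.+1 | (primes_ge k).-nat d]|%:R :> R.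
  by rewrite !mulr_ge0 // ltW.
have := ler_wpM2l M0 (card_rough_ge (R := R) k T k2 kT); lra.
Qed.
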